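(* Let $\theta\in[0,2\pi)$, $u,v\in\mathbb H$, and let $\Omega,\Xi\subset\mathbb H$ be conformally equivalent domains with $T(\Xi)=\Omega$, where $T(z)=(az+b)(cz+d)^{-1}$ is a quaternionic Möbius transformation ($a,b,c,d\in\mathbb H$, with $ad\ne0$ if $c=0$ and $b-ac^{-1}d\neq0$ if $c\ne0$). Put $\zeta=T(z)\in\Omega$ for $z\in\Xi$. Then for all $f\in C^1(\Omega,\mathbb H)$, on $\Xi$, $${}^\theta_u\mathcal D_z\big[e^{\langle v-u,z\rangle_\theta}A_T\,(f\circ T)\big]=e^{\langle v-u,z\rangle_\theta}\,(B_T\circ T)\,\big({}^\theta_{\delta_T}\mathcal D_\zeta[f]\big)\circ T,$$ where $\delta_T=(B_T)^{-1}\,v\,(A_T\circ T^{-1})$ on $\Omega$, with $(B_T)^{-1}$ the (pointwise) multiplicative inverse of $B_T$ and $T^{-1}$ the inverse mapping of $T$, and ${}^\theta_{\delta_T}\mathcal D_\zeta[f]={}^\theta\mathcal D_\zeta[f]+\delta_Tf$.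
   Context: $\mathbb H$ denotes the real quaternions with units $i,j,k$; $\overline{q}$ is quaternionic conjugation and $|q|$ the Euclidean norm. Put $\psi_0=1,\ \psi_1=i,\ \psi_2=ie^{i\theta}j,\ \psi_3=e^{i\theta}j$, a real orthonormal basis of $\mathbb H$; every $z\in\mathbb H$ is written $z=\sum_{k=0}^3x_k\psi_k$, $x_k\in\mathbb R$. For $x=\sum x_k\psi_k$, $y=\sum y_k\psi_k$ set $\langle x,y\rangle_\theta=\sum_{k=0}^3x_ky_k$. For $C^1$ functions, ${}^\theta\mathcal D[f]=\sum_{k}\psi_k\frac{\partial f}{\partial x_k}$ and ${}^\theta_u\mathcal D[f]={}^\theta\mathcal D[f]+uf$; a subscript $z$ or $\zeta$ indicates the quaternionic variable of differentiation. ($T$ is well defined on $\Xi$, i.e. $cz+d\ne0$ there.) The conformal weights are, for $z\in\Xi$ and $\zeta\in\Omega$: if $c=0$, $A_T(z)=\bar d$ and $B_T(\zeta)=\bar a$; if $c\ne0$, with $\beta=b-ac^{-1}d$ and $y=cz\beta^{-1}+d\beta^{-1}$, $$A_T(z)=\bar\beta\,\frac{\bar y}{|y|^4},\qquad B_T(\zeta)=-\bar c\;\overline{(\zeta-ac^{-1})}\;|\zeta-ac^{-1}|^4 .$$ *)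

(* Defs.v *)
From HB Require Import structures.
From mathcomp Require Import all_boot all_order all_algebra.
From mathcomp Require Import all_classical all_reals all_analysis.
From mathcomp Require Import ring lra.

Set Implicit Arguments.
Unset Strict Implicit.
Unset Printing Implicit Defensive.

Import Order.TTheory GRing.Theory Num.Theory.
Import numFieldNormedType.Exports.

Local Open Scope classical_set_scope.
Local Open Scope ring_scope.

(* [q] stores the real coefficients of 1, i, j, k.  The library norm [`|q|]
   inherited from ['rV[R]_4] is the max-norm (it induces the usual topology and
   hence the usual derivatives); the Euclidean norm is [qnorm] below. *)
Definition quat (R : realType) : Type := 'rV[R]_4.

HB.instance Definition _ (R : realType) := NormedModule.copy (quat R) 'rV[R]_4.
HB.instance Definition _ (R : realType) := Vector.copy (quat R) 'rV[R]_4.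

Section Quaternions.
Variable R : realType.
Implicit Types p q r : quat R.

Definition Quat (s x y z : R) : quat R :=
  \row_(i < 4) nth 0 [:: s; x; y; z] i.

Definition q0 q : R := q ord0 (inord 0).
Definition q1 q : R := q ord0 (inord 1).
Definition q2 q : R := q ord0 (inord 2).
Definition q3 q : R := q ord0 (inord 3).

Lemma Quat0 s x y z : q0 (Quat s x y z) = s.
Proof. by rewrite /q0 mxE inordK. Qed.
Lemma Quat1 s x y z : q1 (Quat s x y z) = x.
Proof. by rewrite /q1 mxE inordK. Qed.
Lemma Quat2 s x y z : q2 (Quat s x y z) = y.
Proof. by rewrite /q2 mxE inordK. Qed.
Lemma Quat3 s x y z : q3 (Quat s x y z) = z.
Proof. by rewrite /q3 mxE inordK. Qed.
Definition QuatE := (Quat0, Quat1, Quat2, Quat3).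

Lemma quatP p q :
  [/\ q0 p = q0 q, q1 p = q1 q, q2 p = q2 q & q3 p = q3 q] -> p = q.
Proof.
move=> [h0 h1 h2 h3]; apply/rowP => -[[|[|[|[|//]]]] hi].
- by have -> : Ordinal hi = inord 0 by apply/val_inj; rewrite /= inordK.
- by have -> : Ordinal hi = inord 1 by apply/val_inj; rewrite /= inordK.
- by have -> : Ordinal hi = inord 2 by apply/val_inj; rewrite /= inordK.
- by have -> : Ordinal hi = inord 3 by apply/val_inj; rewrite /= inordK.
Qed.

Lemma quatD p q : [/\ q0 (p + q) = q0 p + q0 q, q1 (p + q) = q1 p + q1 q,
  q2 (p + q) = q2 p + q2 q & q3 (p + q) = q3 p + q3 q].
Proof. by rewrite /q0 /q1 /q2 /q3 !mxE. Qed.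

Lemma quatZ (t : R) q : [/\ q0 (t *: q) = t * q0 q, q1 (t *: q) = t * q1 q,
  q2 (t *: q) = t * q2 q & q3 (t *: q) = t * q3 q].
Proof. by rewrite /q0 /q1 /q2 /q3 !mxE. Qed.

Definition qone : quat R := Quat 1 0 0 0.

Definition qmul p q : quat R := Quat
  (q0 p * q0 q - q1 p * q1 q - q2 p * q2 q - q3 p * q3 q)
  (q0 p * q1 q + q1 p * q0 q + q2 p * q3 q - q3 p * q2 q)
  (q0 p * q2 q - q1 p * q3 q + q2 p * q0 q + q3 p * q1 q)
  (q0 p * q3 q + q1 p * q2 q - q2 p * q1 q + q3 p * q0 q).

Fact qmulA : associative qmul.
Proof. by move=> p q r; apply: quatP; rewrite !QuatE; split; ring. Qed.

Fact qmul1q : left_id qone qmul.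
Proof. by move=> q; apply: quatP; rewrite !QuatE; split; ring. Qed.

Fact qmulq1 : right_id qone qmul.
Proof. by move=> q; apply: quatP; rewrite !QuatE; split; ring. Qed.

Fact qmulDl : left_distributive qmul +%R.
Proof.
move=> p q r; apply: quatP.
have [-> -> -> ->] := quatD (qmul p r) (qmul q r).
by rewrite !QuatE; have [-> -> -> ->] := quatD p q; split; ring.
Qed.

Fact qmulDr : right_distributive qmul +%R.
Proof.
move=> p q r; apply: quatP.
have [-> -> -> ->] := quatD (qmul p q) (qmul p r).
by rewrite !QuatE; have [-> -> -> ->] := quatD q r; split; ring.
Qed.

Fact qone_neq0 : qone != 0.
Proof.
apply/eqP => /(congr1 q0); rewrite Quat0 /q0 mxE => /eqP.
by rewrite oner_eq0.
Qed.

HB.instance Definition _ := GRing.Zmodule_isNzRing.Build (quat R)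
  qmulA qmul1q qmulq1 qmulDl qmulDr qone_neq0.

Fact qscaleAl (t : R) p q : t *: (p * q) = (t *: p) * q.
Proof.
apply: quatP; have [-> -> -> ->] := quatZ t (p * q).
by rewrite !QuatE; have [-> -> -> ->] := quatZ t p; split; ring.
Qed.

Fact qscaleAr (t : R) p q : t *: (p * q) = p * (t *: q).
Proof.
apply: quatP; have [-> -> -> ->] := quatZ t (p * q).
by rewrite !QuatE; have [-> -> -> ->] := quatZ t q; split; ring.
Qed.

HB.instance Definition _ :=
  GRing.Lmodule_isLalgebra.Build R (quat R) qscaleAl.
HB.instance Definition _ :=
  GRing.Lalgebra_isAlgebra.Build R (quat R) qscaleAr.

Definition qconj q : quat R := Quat (q0 q) (- q1 q) (- q2 q) (- q3 q).

Definition qnorm q : R :=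
  Num.sqrt (q0 q ^+ 2 + q1 q ^+ 2 + q2 q ^+ 2 + q3 q ^+ 2).

Lemma qnorm_eq0 q : (qnorm q == 0) = (q == 0).
Proof.
apply/idP/eqP => [|->]; last first.
  by rewrite /qnorm /q0 /q1 /q2 /q3 !mxE expr0n /= !addr0 sqrtr0.
rewrite sqrtr_eq0 => h; apply: quatP.
have z0 : [/\ q0 (0 : quat R) = 0, q1 (0 : quat R) = 0,
  q2 (0 : quat R) = 0 & q3 (0 : quat R) = 0] by rewrite /q0 /q1 /q2 /q3 !mxE.
have [-> -> -> ->] := z0.
have := sqr_ge0 (q0 q); have := sqr_ge0 (q1 q).
have := sqr_ge0 (q2 q); have := sqr_ge0 (q3 q).
by move=> ? ? ? ?; split; apply/eqP; rewrite -sqrf_eq0; apply/eqP; lra.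
Qed.

Lemma qnorm_sqr q :
  qnorm q ^+ 2 = q0 q ^+ 2 + q1 q ^+ 2 + q2 q ^+ 2 + q3 q ^+ 2.
Proof. by rewrite sqr_sqrtr // !addr_ge0 ?sqr_ge0. Qed.

Lemma qmul_conj q : q * qconj q = (qnorm q ^+ 2) *: 1.
Proof.
apply: quatP; have [-> -> -> ->] := quatZ (qnorm q ^+ 2) 1.
by rewrite qnorm_sqr !QuatE; split; ring.
Qed.

Lemma qconj_mul q : qconj q * q = (qnorm q ^+ 2) *: 1.
Proof.
apply: quatP; have [-> -> -> ->] := quatZ (qnorm q ^+ 2) 1.
by rewrite qnorm_sqr !QuatE; split; ring.
Qed.

Definition qunit : {pred quat R} := [pred q | q != 0].

(* Totalised with [qinv 0 = 0]: [qnorm 0 = 0] and [0^-1 = 0] in [R]. *)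
Definition qinv q : quat R := (qnorm q ^- 2) *: qconj q.

Fact qmulVq : {in qunit, left_inverse 1 qinv *%R}.
Proof.
move=> q /[!inE] qn0; rewrite /qinv -scalerAl qconj_mul scalerA mulVf ?scale1r//.
by rewrite expf_eq0 qnorm_eq0.
Qed.

Fact qmulqV : {in qunit, right_inverse 1 qinv *%R}.
Proof.
move=> q /[!inE] qn0; rewrite /qinv -scalerAr qmul_conj scalerA mulVf ?scale1r//.
by rewrite expf_eq0 qnorm_eq0.
Qed.

Fact qunitP p q : q * p = 1 /\ p * q = 1 -> p \in qunit.
Proof.
move=> [qp1 _]; rewrite inE; apply/eqP => p0.
by move: qp1; rewrite p0 mulr0 => /esym/eqP; rewrite oner_eq0.
Qed.

Fact qinv_out : {in [predC qunit], qinv =1 id}.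
Proof.
move=> q; rewrite inE /= negbK => /eqP ->.
have /eqP n0 : qnorm 0 == 0 by rewrite qnorm_eq0.
by rewrite /qinv n0 expr0n invr0 scale0r.
Qed.

HB.instance Definition _ := GRing.NzRing_hasMulInverse.Build (quat R)
  qmulVq qmulqV qunitP qinv_out.

Definition qi : quat R := Quat 0 1 0 0.
Definition qj : quat R := Quat 0 0 1 0.
Definition qk : quat R := Quat 0 0 0 1.

Lemma qi2 : qi * qi = -1.
Proof.
by apply/eqP; rewrite -addr_eq0; apply/eqP/quatP;
  have [-> -> -> ->] := quatD (qi * qi) 1; rewrite !QuatE /q0 /q1 /q2 /q3 !mxE;
  split; ring.
Qed.

Lemma qij : qi * qj = qk.
Proof. by apply: quatP; rewrite !QuatE; split; ring. Qed.

Definition qexpi (theta : R) : quat R := cos theta *: 1 + sin theta *: qi.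

Definition psi (theta : R) : 4.-tuple (quat R) :=
  [tuple 1; qi; qi * qexpi theta * qj; qexpi theta * qj].

Lemma psiE theta : psi theta = [tuple Quat 1 0 0 0; Quat 0 1 0 0;
  Quat 0 0 (- sin theta) (cos theta); Quat 0 0 (cos theta) (sin theta)].
Proof.
have expE : qexpi theta = Quat (cos theta) (sin theta) 0 0.
  apply: quatP; rewrite /qexpi.
  have [-> -> -> ->] := quatD (cos theta *: 1) (sin theta *: qi).
  have [-> -> -> ->] := quatZ (cos theta) 1.
  by have [-> -> -> ->] := quatZ (sin theta) qi; rewrite !QuatE; split; ring.
apply: val_inj; rewrite /= expE; congr [:: _; _; _; _];
  by apply: quatP; rewrite !QuatE; split; ring.
Qed.

Lemma psi_basis theta : basis_of fullv (psi theta).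
Proof.
rewrite psiE basisEfree subvf dimvf /dim /= andbT; apply/freeP => t.
rewrite !big_ord_recl big_ord0 /= addr0.
set t0 := t ord0; set t1 := t _; set t2 := t _; set t3 := t _ => sum0.
have comb0 : Quat t0 t1 (- t2 * sin theta + t3 * cos theta)
    (t2 * cos theta + t3 * sin theta) = 0.
  rewrite -[RHS]sum0; apply/rowP => -[[|[|[|[|//]]]] hi]; rewrite !mxE /=; ring.
have /= c0 := congr1 (fun q : quat R => [:: q0 q; q1 q; q2 q; q3 q]) comb0.
move: c0; rewrite !QuatE /q0 /q1 /q2 /q3 !mxE => -[e0 e1 e2 e3].
have sc := cos2Dsin2 theta.
have e4 : t2 = 0.
  transitivity (t2 * (cos theta ^+ 2 + sin theta ^+ 2)); first by rewrite sc mulr1.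
  transitivity (cos theta * (t2 * cos theta + t3 * sin theta)
    - sin theta * (- t2 * sin theta + t3 * cos theta)); first by ring.
  by rewrite e2 e3 !mulr0 subr0.
have e5 : t3 = 0.
  transitivity (t3 * (cos theta ^+ 2 + sin theta ^+ 2)); first by rewrite sc mulr1.
  transitivity (sin theta * (t2 * cos theta + t3 * sin theta)
    + cos theta * (- t2 * sin theta + t3 * cos theta)); first by ring.
  by rewrite e2 e3 !mulr0 addr0.
case=> -[|[|[|[|//]]]] hi.
- by rewrite -[RHS]e0; congr t; apply/val_inj.
- by rewrite -[RHS]e1; congr t; apply/val_inj.
- by rewrite -[RHS]e4; congr t; apply/val_inj.
- by rewrite -[RHS]e5; congr t; apply/val_inj.
Qed.

Definition theta_dot (theta : R) (x y : quat R) : R :=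
  \sum_(k < 4) coord (psi theta) k x * coord (psi theta) k y.

(* The partial derivative with respect to [x_k] is the derivative along
   [psi_k]. *)
Definition dirac (theta : R) (f : quat R -> quat R) (z : quat R) : quat R :=
  \sum_(k < 4) (psi theta)`_k * 'D_((psi theta)`_k) f z.

Definition dirac_w (theta : R) (w : quat R -> quat R) (f : quat R -> quat R)
    (z : quat R) : quat R :=
  dirac theta f z + w z * f z.

(* In finite dimension, continuity of all directional derivatives is continuity
   of the differential.  Since [U] is open, continuity within [U] of the
   derivatives is continuity at each of its points. *)
Definition C1_on (U : set (quat R)) (f : quat R -> quat R) : Prop :=
  forall z, U z ->
    differentiable f z /\ forall h : quat R, {for z, continuous ('D_h f)}.

Definition domain (U : set (quat R)) : Prop :=
  [/\ U !=set0, open U & connected U].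

Definition mobius (a b c d z : quat R) : quat R :=
  (a * z + b) * (c * z + d)^-1.

Definition mobius_nondeg (a b c d : quat R) : Prop :=
  if c == 0 then a * d != 0 else b - a * c^-1 * d != 0.

Definition weightA (a b c d z : quat R) : quat R :=
  if c == 0 then qconj d else
    let beta := b - a * c^-1 * d in
    let y := c * z * beta^-1 + d * beta^-1 in
    qconj beta * (qnorm y ^- 4 *: qconj y).

Definition weightB (a b c d zeta : quat R) : quat R :=
  if c == 0 then qconj a else
    let w := zeta - a * c^-1 in
    - qconj c * (qnorm w ^+ 4 *: qconj w).

(* [delta_T = B_T^-1 v (A_T o T^-1)], where [T^-1] is the inverse of the
   restriction of [T] to [Xi]; ['pinv_(_) Xi T] is this inverse on [T @` Xi]
   and a dummy constant elsewhere. *)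
Definition delta_weight (a b c d v : quat R) (Xi : set (quat R))
    (zeta : quat R) : quat R :=
  (weightB a b c d zeta)^-1 * v *
    weightA a b c d ('pinv_(fun=> 0) Xi (mobius a b c d) zeta).

End Quaternions.

Arguments qi {R}.
Arguments qj {R}.
Arguments qk {R}.

(* Main.v *)
From HB Require Import structures.
Require Import Defs.
From mathcomp Require Import all_boot all_order all_algebra.
From mathcomp Require Import all_classical all_reals all_analysis.
From mathcomp Require Import ring.
Import Order.TTheory GRing.Theory Num.Theory.
Import numFieldNormedType.Exports.
Local Open Scope classical_set_scope.
Local Open Scope ring_scope.

(** The Dirac operator at [z] only sees the differential [L] of the function: it
is the sum [dirac_diff theta L] of the [psi_k * L psi_k].  Hence every
differentiable factor is handled by an explicit Frechet differential, and the
theorem becomes an identity between such sums.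

Three facts about them carry the proof.

- Conformal covariance ([dirac_diff_conformal]): moving [h |-> p h q] from the
  inside of [L] to the outside costs the factor [|q|^2 conj p].  This holds
  because [psi] is orthonormal and left (right) multiplication by a quaternion
  has left (right) multiplication by its conjugate as adjoint.
- The differential of a Moebius map has exactly this shape ([is_diff_mobius]):
  [T'(z) h = (a - T(z) c) h (c z + d)^-1].  This formula covers [c = 0] and
  [c <> 0] alike.
- [A_T] is annihilated by the Dirac operator ([weightA_monogenic]).  It is
  constant if [c = 0]; otherwise it is a constant multiple of the Cauchy kernel
  [conj y / |y|^4] evaluated at an affine function of [z], so conformal
  covariance reduces the claim to the monogenicity of the kernel.

By the Leibniz rule, differentiating the exponential contributes
[(v - u) A_T (f o T)], which together with the term [u g] gives [v A_T (f o T)],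
the zeroth order term on the right by definition of [delta_T].  The derivative
of [A_T] contributes nothing.  In the derivative of [f o T], [A_T(z)] is a real
multiple of [(c z + d)^-1], so conformal covariance applies with
[p = a - T(z) c] and [q = (c z + d)^-1], and the resulting factor is
[B_T(T(z))] ([weight_factor]). *)

Set Implicit Arguments.
Unset Strict Implicit.

Section DiracMobius.
Variable R : realType.
Implicit Types (theta : R) (p q z : quat R).

(** * Quaternion algebra *)

Lemma quatM p q : [/\
  q0 (p * q) = q0 p * q0 q - q1 p * q1 q - q2 p * q2 q - q3 p * q3 q,
  q1 (p * q) = q0 p * q1 q + q1 p * q0 q + q2 p * q3 q - q3 p * q2 q,
  q2 (p * q) = q0 p * q2 q - q1 p * q3 q + q2 p * q0 q + q3 p * q1 q &
  q3 (p * q) = q0 p * q3 q + q1 p * q2 q - q2 p * q1 q + q3 p * q0 q].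
Proof. by rewrite !QuatE. Qed.

Lemma quatN q :
  [/\ q0 (- q) = - q0 q, q1 (- q) = - q1 q, q2 (- q) = - q2 q
    & q3 (- q) = - q3 q].
Proof. by rewrite /q0 /q1 /q2 /q3 !mxE. Qed.

Lemma quat1 : [/\ q0 (1 : quat R) = 1, q1 (1 : quat R) = 0,
  q2 (1 : quat R) = 0 & q3 (1 : quat R) = 0].
Proof. by rewrite !QuatE. Qed.

Lemma qconjE q : [/\ q0 (qconj q) = q0 q, q1 (qconj q) = - q1 q,
  q2 (qconj q) = - q2 q & q3 (qconj q) = - q3 q].
Proof. by rewrite !QuatE. Qed.

(** Turns a conjunction of equations into a tuple, which [rewrite] accepts as a
multirule. *)
Lemma unpack4 (P1 P2 P3 P4 : Prop) :
  [/\ P1, P2, P3 & P4] -> P1 * P2 * P3 * P4.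
Proof. by case. Qed.

Definition coordE := (QuatE, fun p q => unpack4 (quatD p q),
  fun t q => unpack4 (quatZ t q), fun p q => unpack4 (quatM p q),
  fun q => unpack4 (quatN q), unpack4 quat1, fun q => unpack4 (qconjE q)).

Lemma qconjM p q : qconj (p * q) = qconj q * qconj p.
Proof. by apply: quatP; rewrite !coordE; split; ring. Qed.

Lemma qconjN q : qconj (- q) = - qconj q.
Proof. by apply: quatP; rewrite !coordE. Qed.

Lemma qconj_linear : linear (@qconj R).
Proof. by move=> t p q; apply: quatP; rewrite !coordE; split; ring. Qed.

Lemma qnorm_sqrM p q : qnorm (p * q) ^+ 2 = qnorm p ^+ 2 * qnorm q ^+ 2.
Proof. by rewrite !qnorm_sqr !coordE; ring. Qed.

Lemma qnorm_sqr_eq0 q : (qnorm q ^+ 2 == 0) = (q == 0).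
Proof. by rewrite expf_eq0 qnorm_eq0. Qed.

Lemma qmul_eq0 p q : (p * q == 0) = (p == 0) || (q == 0).
Proof. by rewrite -!qnorm_sqr_eq0 qnorm_sqrM mulf_eq0. Qed.

Lemma qunitE q : (q \is a GRing.unit) = (q != 0).
Proof. by []. Qed.

Lemma qinvE q : q^-1 = (qnorm q ^+ 2)^-1 *: qconj q.
Proof. by []. Qed.

Lemma qnorm_sqrV q : qnorm q^-1 ^+ 2 = (qnorm q ^+ 2)^-1.
Proof.
have [->|qn0] := eqVneq q 0.
  rewrite invr0; have /eqP -> : qnorm 0 ^+ 2 == 0 :> R by rewrite qnorm_sqr_eq0.
  by rewrite invr0.
have N0 : qnorm q ^+ 2 != 0 by rewrite qnorm_sqr_eq0.
apply: (mulfI N0); rewrite -qnorm_sqrM divrr ?qunitE // divff //.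
by rewrite qnorm_sqr !coordE; ring.
Qed.

Lemma qconj_qinv q : qconj q = qnorm q ^+ 2 *: q^-1.
Proof.
have [->|qn0] := eqVneq q 0.
  rewrite invr0 scaler0; apply: quatP.
  by rewrite !coordE /q0 /q1 /q2 /q3 !mxE oppr0.
by rewrite qinvE scalerA divff ?scale1r // qnorm_sqr_eq0.
Qed.

Definition qdot p q : R :=
  q0 p * q0 q + q1 p * q1 q + q2 p * q2 q + q3 p * q3 q.

Lemma qdotC p q : qdot p q = qdot q p.
Proof. by rewrite /qdot; ring. Qed.

Lemma qdot_linear p : linear (qdot p : _ -> R).
Proof. by move=> t q r; rewrite /qdot !coordE /GRing.scale /=; ring. Qed.

Lemma qdot_mull p q z : qdot (p * q) z = qdot q (qconj p * z).
Proof. by rewrite /qdot !coordE; ring. Qed.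

Lemma qdot_mulr p q z : qdot (q * p) z = qdot q (z * qconj p).
Proof. by rewrite /qdot !coordE; ring. Qed.

(** Up to the factor [|p|^2], [q |-> conj p * q * conj p] is [conj] followed by
the reflection in the line through [conj p].  The identity brings the
differential of [conj p / |p|^2] into the form [- p^-1 * h * p^-1]. *)
Lemma qconj_sandwich p q :
  qconj p * q * qconj p = (2 * qdot p q) *: qconj p - qnorm p ^+ 2 *: qconj q.
Proof. by apply: quatP; rewrite /qdot qnorm_sqr !coordE; split; ring. Qed.

Lemma linear_sumZ (V W : lmodType R) (L : V -> W) n (t : 'I_n -> R)
    (x : 'I_n -> V) : linear L ->
  L (\sum_(k < n) t k *: x k) = \sum_(k < n) t k *: L (x k).
Proof.
move=> linL.
pose LM := GRing.isLinear.Build _ _ _ _ _ linL.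
pose L' : {linear _ -> _} := HB.pack L LM.
rewrite -[L]/(L' : _ -> _) linear_sum.
by apply: eq_bigr => k _; rewrite linearZ.
Qed.

(** * Differentials of quaternionic functions *)

Lemma quat_coord_continuous (i : 'I_4) :
  continuous (fun q : quat R => q ord0 i).
Proof. exact: coord_continuous. Qed.

Lemma linear_quat_continuous (W : normedModType R) (L : quat R -> W) :
  linear L -> continuous L.
Proof.
move=> linL.
have -> : L = (fun q => \sum_(i < 4) q ord0 i *: L (delta_mx 0 i)).
  apply/funext => q; rewrite [in LHS](row_sum_delta q).
  exact: (linear_sumZ _ _ linL).
apply: continuous_big => [|i _]; first exact: add_continuous.
by move=> q; apply: continuousZr_tmp; exact: quat_coord_continuous.
Qed.

Lemma is_diff_linear (W : normedModType R) (L : quat R -> W) z :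
  linear L -> is_diff z L L.
Proof.
move=> linL; have cL := linear_quat_continuous linL.
pose LM := GRing.isLinear.Build _ _ _ _ _ linL.
pose L' : {linear _ -> _} := HB.pack L LM.
apply: DiffDef; first exact: (@linear_differentiable _ _ _ L').
exact: (@diff_lin _ _ _ L').
Qed.

Lemma is_diff_affine p q r z :
  is_diff z (fun x => p * x * q + r) (fun h => p * h * q).
Proof.
have lin : linear (fun h => p * h * q).
  by move=> t x y; rewrite mulrDr mulrDl -scalerAr -scalerAl.
have D := is_diffD (is_diff_linear z lin) (is_diff_cst r z).
by apply: (is_diff_eq D); rewrite addr0.
Qed.

Lemma qmul_continuous : continuous (fun x : quat R * quat R => x.1 * x.2).
Proof.
have -> : (fun x : quat R * quat R => x.1 * x.2) =
  (fun x => \sum_(i < 4) x.1 ord0 i *: ((delta_mx 0 i : quat R) * x.2)).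
  apply/funext => x; rewrite [in LHS](row_sum_delta x.1) mulr_suml.
  by apply: eq_bigr => i _; rewrite scalerAl.
apply: continuous_big => [|i _]; first exact: add_continuous.
move=> x; apply: (@continuousZ R (quat R) (quat R * quat R)%type
  (fun x => x.1 ord0 i) (fun x => (delta_mx 0 i : quat R) * x.2)).
  apply: (@continuous_comp _ _ _ fst (fun q : quat R => q ord0 i)).
    exact: cvg_fst.
  exact: quat_coord_continuous.
apply: (@continuous_comp _ _ _ snd ( *%R (delta_mx 0 i : quat R))).
  exact: cvg_snd.
by apply: linear_quat_continuous => t y z; rewrite mulrDr scalerAr.
Qed.

Lemma qmul_bilinear :
  bilinear_for
    (GRing.Scale.Law.clone _ _ *:%R _) (GRing.Scale.Law.clone _ _ *:%R _)
    (@GRing.mul (quat R)).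
Proof.
split=> [p|p] t x y /=; first by rewrite mulrDl scalerAl.
by rewrite mulrDr scalerAr.
Qed.

Lemma is_diff_qmul (V : normedModType R) (F G dF dG : V -> quat R) (z : V) :
  is_diff z F dF -> is_diff z G dG ->
  is_diff z (fun x => F x * G x) (fun h => F z * dG h + dF h * G z).
Proof.
move=> dFz dGz.
have dM : is_diff (F z, G z) (fun x : quat R * quat R => x.1 * x.2)
    (fun x => F z * x.2 + x.1 * G z).
  pose B := bilinear_isBilinear.Build R _ _ _ _ _ _ qmul_bilinear.
  pose M : {bilinear quat R -> quat R -> quat R} :=
    HB.pack (@GRing.mul (quat R)) B.
  by apply: DiffDef;
    [exact: (differentiable_bilin (f := M) _ qmul_continuous)
    |exact: (diff_bilin (f := M) _ qmul_continuous)].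
exact: (@is_diff_comp _ _ _ _ (fun x => (F x, G x)) (fun h => (dF h, dG h))).
Qed.

Lemma is_diff_scale (V : normedModType R) (F dF : V -> R) (G dG : V -> quat R)
    (z : V) :
  is_diff z F dF -> is_diff z G dG ->
  is_diff z (fun x => F x *: G x) (fun h => F z *: dG h + dF h *: G z).
Proof.
move=> dFz dGz.
have dF1 : is_diff z (fun x => (F x)%:A : quat R) (fun h => (dF h)%:A).
  exact: (@is_diff_comp _ _ _ _ F dF ( *:%R^~ (1 : quat R))).
have algE (t : R) q : t *: q = t%:A * q by rewrite -scalerAl mul1r.
have -> : (fun x => F x *: G x) = (fun x => (F x)%:A * G x).
  by apply/funext => x; exact: algE.
have -> : (fun h => F z *: dG h + dF h *: G z) =
  (fun h => (F z)%:A * dG h + (dF h)%:A * G z).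
  by apply/funext => h; rewrite (algE (F z)) (algE (dF h)).
exact: is_diff_qmul.
Qed.

Lemma is_diff_qconj z : is_diff z (@qconj R) (@qconj R).
Proof. exact: is_diff_linear (@qconj_linear). Qed.

Lemma is_diff_qnorm_sqr z :
  is_diff z (fun q => qnorm q ^+ 2) (fun h => 2 * qdot z h).
Proof.
have -> : (fun q : quat R => qnorm q ^+ 2) = @q0 R \o (fun q => q * qconj q).
  by apply/funext => q /=; rewrite qmul_conj !coordE mulr1.
have -> : (fun h => 2 * qdot z h) =
    @q0 R \o (fun h => z * qconj h + h * qconj z).
  by apply/funext => h /=; rewrite /qdot !coordE; ring.
have dM := is_diff_qmul (is_diff_id z) (is_diff_qconj z).
have dq0 : is_diff (z * qconj z) (@q0 R) (@q0 R).
  by apply: is_diff_linear => t p q; rewrite !coordE.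
exact: (@is_diff_comp _ _ _ _ _ _ _ _ _ dM dq0).
Qed.

(** The case [n = 0] is the quaternionic inverse, the case [n = 1] the Cauchy
kernel. *)
Lemma is_diff_qconj_div_qnorm n z : z != 0 ->
  is_diff z (fun q => (qnorm q ^+ 2) ^- n.+1 *: qconj q)
    (fun h => (qnorm z ^+ 2) ^- n.+1 *: qconj h
      - (n.+1%:R * 2 * qdot z h * (qnorm z ^+ 2) ^- n.+2) *: qconj z).
Proof.
move=> z0; set N := qnorm z ^+ 2.
have N0 : N != 0 by rewrite qnorm_sqr_eq0.
have dV : is_diff N (fun x : R => x^-1) ( *:%R (- N ^- 2)).
  by apply: DiffDef; [exact: differentiable_Rinv|exact: diff_Rinv].
have dP := @is_diff_comp _ _ _ _ _ _ _ _ _ (is_diff_qnorm_sqr z) dV.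
have := is_diff_scale (is_diffX n dP) (is_diff_qconj z).
have -> : (fun x : quat R =>
    ((((fun y : R => y^-1) \o (fun q => qnorm q ^+ 2)) : quat R -> R) ^+ n.+1) x
      *: qconj x) = (fun q => (qnorm q ^+ 2) ^- n.+1 *: qconj q).
  by apply/funext => q; rewrite exprfctE /= exprVn.
move=> D; apply: (is_diff_eq D); apply/funext => h.
rewrite exprfctE /= exprVn -/N; congr (_ + _).
rewrite -scaleNr; congr (_ *: _); rewrite /GRing.scale /=.
have -> : N ^- n.+2 = N ^- n * N ^- 2 by rewrite -invfM -exprD addn2.
by rewrite exprVn /GRing.scale /=; ring.
Qed.

Lemma is_diff_qinv z : z != 0 ->
  is_diff z (fun q => q^-1) (fun h => - (z^-1 * h * z^-1)).
Proof.
move=> z0; have D := is_diff_qconj_div_qnorm 0 z0.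
apply: (is_diff_eq D); apply/funext => h.
rewrite qinvE; set N := qnorm z ^+ 2.
have N0 : N != 0 by rewrite qnorm_sqr_eq0.
rewrite -!scalerAl -scalerAr qconj_sandwich -/N !scalerBr !scalerA opprB.
by congr (_ *: _ - _ *: _); rewrite /GRing.scale /=; field.
Qed.

(** * The structural set as an orthonormal basis *)

Lemma psi_expansion theta q :
  \sum_(k < 4) qdot q (psi theta)`_k *: (psi theta)`_k = q.
Proof.
rewrite psiE !big_ord_recl big_ord0 /= addr0 /qdot !QuatE.
set c := cos theta; set s := sin theta.
have s2 : s ^+ 2 = 1 - c ^+ 2 by rewrite -(cos2Dsin2 theta) /c /s; ring.
by apply: quatP; rewrite !coordE; split; ring: s2.
Qed.

Lemma qnorm_sqr_psi theta (k : 'I_4) : qnorm (psi theta)`_k ^+ 2 = 1.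
Proof.
have s2 := cos2Dsin2 theta.
rewrite psiE qnorm_sqr; case: k => -[|[|[|[|//]]]] hk /=;
  by rewrite !QuatE ?sqrrN ?expr0n ?expr1n ?addr0 ?add0r // addrC.
Qed.

Lemma linear_psiE theta (L : quat R -> quat R) q : linear L ->
  L q = \sum_(k < 4) qdot q (psi theta)`_k *: L (psi theta)`_k.
Proof.
by move=> linL; rewrite -[in LHS](psi_expansion theta q) linear_sumZ.
Qed.

Lemma theta_dotE theta p q : theta_dot theta p q = qdot p q.
Proof.
have coord_psi k x : coord (psi theta) k x = qdot x (psi theta)`_k.
  rewrite -[in LHS](psi_expansion theta x) coord_sum_free //.
  exact: basis_free (psi_basis theta).
rewrite /theta_dot qdotC; under eq_bigr => k _ do rewrite !coord_psi.
rewrite -[in RHS](psi_expansion theta p).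
by rewrite (linear_sumZ _ _ (@qdot_linear q)).
Qed.

(** * The Dirac operator as a function of the differential *)

(** The value at a point of the Dirac operator on any function whose
differential there is [L]. *)
Definition dirac_diff theta (L : quat R -> quat R) : quat R :=
  \sum_(k < 4) (psi theta)`_k * L (psi theta)`_k.

Lemma diracE theta (F dF : quat R -> quat R) z :
  is_diff z F dF -> Defs.dirac theta F z = dirac_diff theta dF.
Proof. by move=> dFz; apply: eq_bigr => k _; rewrite deriveE ?diff_val. Qed.

Lemma dirac_diff0 theta : dirac_diff theta (fun=> 0) = 0.
Proof. by rewrite /dirac_diff big1 // => k _; rewrite mulr0. Qed.

Lemma dirac_diffD theta L M :
  dirac_diff theta (fun h => L h + M h) =
  dirac_diff theta L + dirac_diff theta M.
Proof.
by rewrite /dirac_diff -big_split; apply: eq_bigr => k _; rewrite mulrDr.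
Qed.

Lemma dirac_diffZ theta t L :
  dirac_diff theta (fun h => t *: L h) = t *: dirac_diff theta L.
Proof.
by rewrite /dirac_diff scaler_sumr; apply: eq_bigr => k _; rewrite scalerAr.
Qed.

Lemma dirac_diff_mulr theta L c :
  dirac_diff theta (fun h => L h * c) = dirac_diff theta L * c.
Proof.
by rewrite /dirac_diff mulr_suml; apply: eq_bigr => k _; rewrite mulrA.
Qed.

Lemma dirac_diff_qdot theta p q :
  dirac_diff theta (fun h => qdot p h *: q) = p * q.
Proof.
rewrite /dirac_diff -[in RHS](psi_expansion theta p) mulr_suml.
by apply: eq_bigr => k _; rewrite -scalerAr scalerAl.
Qed.

Lemma dirac_diff_qconj theta : dirac_diff theta (@qconj R) = 4%:R.
Proof.
rewrite /dirac_diff.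
under eq_bigr => k _ do rewrite qmul_conj qnorm_sqr_psi scale1r.
by rewrite sumr_const card_ord.
Qed.

(** Expand [L (p psi_k q)] along [psi] and exchange the sums.  The coefficient
[<p psi_k q, psi_a>] equals [<psi_k, conj p psi_a conj q>], so the sum over [k]
collapses to [conj p * psi_a * conj q], and [conj q] meets the factor [q] to
give [|q|^2]. *)
Lemma dirac_diff_conformal theta p q (L : quat R -> quat R) : linear L ->
  dirac_diff theta (fun h => q * L (p * h * q)) =
  qnorm q ^+ 2 *: (qconj p * dirac_diff theta L).
Proof.
move=> linL; rewrite /dirac_diff.
under eq_bigr => k _ do rewrite (linear_psiE theta _ linL) !mulr_sumr.
rewrite exchange_big mulr_sumr scaler_sumr; apply: eq_bigr => a _ /=.
transitivity ((\sum_(k < 4) qdot (qconj p * (psi theta)`_a * qconj q)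
    (psi theta)`_k *: (psi theta)`_k) * q * L (psi theta)`_a).
  rewrite !mulr_suml; apply: eq_bigr => k _.
  rewrite -!scalerAr -!scalerAl mulrA; congr (_ *: _).
  by rewrite qdot_mulr qdot_mull mulrA qdotC.
rewrite psi_expansion -(mulrA _ (qconj q)) qconj_mul.
by rewrite -scalerAr mulr1 -scalerAl mulrA.
Qed.

Definition cauchy_kernel z : quat R := qnorm z ^- 4 *: qconj z.

(** With [N = |z|^2], the derivative of [conj z] contributes [4 N^-2], since the
[psi_k conj psi_k] add up to the dimension [4], and that of [N^-2] contributes
[- 4 N^-3 z conj z = - 4 N^-2]. *)
Lemma cauchy_kernel_monogenic theta z : z != 0 ->
  exists2 dK, is_diff z cauchy_kernel dK & dirac_diff theta dK = 0.
Proof.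
move=> z0; have D := is_diff_qconj_div_qnorm 1 z0.
have -> : cauchy_kernel = (fun q => (qnorm q ^+ 2) ^- 2 *: qconj q).
  by apply/funext => q; rewrite -exprM.
eexists; first exact: D.
set N := qnorm z ^+ 2; have N0 : N != 0 by rewrite qnorm_sqr_eq0.
transitivity (dirac_diff theta (fun h => N ^- 2 *: qconj h +
    (- (4 * N ^- 3)) *: (qdot z h *: qconj z))).
  congr dirac_diff; apply/funext => h.
  by rewrite -scaleNr scalerA; congr (_ + _ *: _); ring.
rewrite dirac_diffD !dirac_diffZ dirac_diff_qdot dirac_diff_qconj qmul_conj -/N.
rewrite scalerA -scaler_nat scalerA -scalerDl.
by rewrite [X in X *: _](_ : _ = 0) ?scale0r //; field.
Qed.

(** * Leibniz rule for weighted pullbacks *)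

Lemma is_diff_exp_theta_dot theta w z :
  is_diff z (fun x => expR (theta_dot theta w x))
    (fun h => expR (theta_dot theta w z) * qdot w h).
Proof.
have -> : (fun x => expR (theta_dot theta w x)) = expR \o qdot w.
  by apply/funext => x /=; rewrite theta_dotE.
rewrite theta_dotE.
have dE : is_diff (qdot w z) (@expR R) ( *%R (expR (qdot w z))).
  have dexp : differentiable (@expR R) (qdot w z).
    exact/derivable1_diffP/derivable_expR.
  apply: DiffDef => //; apply/funext => t.
  by rewrite diff1E // derive1E derive_val mulrC.
exact: is_diff_comp (is_diff_linear z (@qdot_linear w)) dE.
Qed.

(** The hypothesis that [A z] is a real multiple of the right factor [q] of the
differential of [T] is what makes [dirac_diff_conformal] applicable to
[A z * 'd (f o T)]. *)
Lemma dirac_weighted_pullback theta w z p q t (T A dA f : quat R -> quat R)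
    (e := fun x => expR (theta_dot theta w x))
    (g := fun x => e x *: (A x * f (T x))) :
  is_diff z T (fun h => p * h * q) -> is_diff z A dA ->
  dirac_diff theta dA = 0 -> A z = t *: q -> differentiable f (T z) ->
  differentiable g z /\
  Defs.dirac theta g z = e z *: (w * (A z * f (T z)) +
     (t * qnorm q ^+ 2) *: (qconj p * Defs.dirac theta f (T z))).
Proof.
move=> dT dAz dA0 Az /differentiableP df.
have dfT := @is_diff_comp _ _ _ _ _ _ _ _ _ dT df.
have dg := is_diff_scale (is_diff_exp_theta_dot theta w z)
  (is_diff_qmul dAz dfT).
split; first by case: dg.
rewrite (diracE theta dg) (diracE theta df) -/(e z).
have linf : linear ('d f (T z)) by exact: linearP.
rewrite -scalerA -dirac_diff_conformal //.
transitivity (dirac_diff theta (fun h => e z *: (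
    t *: (q * 'd f (T z) (p * h * q)) + dA h * f (T z)) +
    e z *: (qdot w h *: (A z * f (T z))))).
  congr dirac_diff; apply/funext => h /=.
  by rewrite Az -scalerAl scalerA.
rewrite dirac_diffD !dirac_diffZ dirac_diffD dirac_diffZ dirac_diff_mulr dA0.
by rewrite mul0r addr0 dirac_diff_qdot -scalerDr addrC.
Qed.

(** * Moebius transformations and their conformal weights *)

Section Mobius.
Variables a b c d : quat R.
Local Notation T := (mobius a b c d).

(** Product rule for [(a z + b) * (c z + d)^-1], the second factor having
differential [- (c z + d)^-1 * c h * (c z + d)^-1]. *)
Lemma is_diff_mobius z : c * z + d != 0 ->
  is_diff z T (fun h => (a - T z * c) * h * (c * z + d)^-1).
Proof.
move=> cz0.
have dlin p r : is_diff z (fun x => p * x + r) ( *%R p).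
  have D := is_diff_affine p 1 r z.
  have -> : (fun x => p * x + r) = (fun x => p * x * 1 + r).
    by apply/funext => x; rewrite mulr1.
  by apply: (is_diff_eq D); apply/funext => h; rewrite mulr1.
have dV := @is_diff_comp _ _ _ _ _ _ _ _ _ (dlin c d) (is_diff_qinv cz0).
have D := is_diff_qmul (dlin a b) dV.
apply: (is_diff_eq D); apply/funext => h /=.
by rewrite /mobius !mulrBl mulrN addrC !mulrA.
Qed.

Lemma mobius_sub z : c != 0 -> c * z + d != 0 ->
  T z - a * c^-1 = (b - a * c^-1 * d) * (c * z + d)^-1.
Proof.
move=> c0 cz0; rewrite /mobius.
rewrite -[X in _ - X](mulrK (x := c * z + d)) ?qunitE //.
rewrite -mulrBl; congr (_ * (c * z + d)^-1).
by rewrite mulrDr mulrA divrK ?qunitE // opprD addrACA subrr add0r.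
Qed.

Lemma mobius_coef z : c != 0 -> a - T z * c = - ((T z - a * c^-1) * c).
Proof. by move=> c0; rewrite mulrBl divrK ?qunitE // opprB. Qed.

Lemma mobius_coef_neq0 z : mobius_nondeg a b c d -> c * z + d != 0 ->
  a - T z * c != 0.
Proof.
rewrite /mobius_nondeg; case: (eqVneq c 0) => [->|c0].
  by rewrite mulr0 subr0 qmul_eq0 negb_or => /andP[].
move=> beta0 cz0; rewrite mobius_coef // oppr_eq0 qmul_eq0 (negbTE c0) orbF.
by rewrite mobius_sub // qmul_eq0 invr_eq0 negb_or beta0.
Qed.

(** If [T x = T y], subtracting the two equations
[a z + b = T y * (c z + d)], for [z = x] and [z = y], gives
[(a - T y * c) * (x - y) = 0]. *)
Lemma mobius_inj x y : mobius_nondeg a b c d ->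
  c * x + d != 0 -> c * y + d != 0 -> T x = T y -> x = y.
Proof.
move=> nondeg cx0 cy0 Txy.
have num z : c * z + d != 0 -> a * z + b = T z * (c * z + d).
  by move=> cz0; rewrite divrK ?qunitE.
have /eqP : (a - T y * c) * (x - y) = 0.
  have ex := num x cx0; have ey := num y cy0; rewrite Txy in ex.
  have : (a * x + b) - (a * y + b) = T y * (c * x + d) - T y * (c * y + d).
    by rewrite ex ey.
  have cancel r s1 s2 : (s1 + r) - (s2 + r) = s1 - s2 :> quat R.
    by rewrite opprD addrACA subrr addr0.
  rewrite -(mulrBr (T y)) !cancel -!mulrBr mulrA => e.
  by rewrite mulrBl e subrr.
rewrite qmul_eq0 (negbTE (mobius_coef_neq0 nondeg cy0)) subr_eq0.
by move=> /eqP.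
Qed.

(** For [c <> 0], [conj beta] is a real multiple of [beta^-1], the right factor
of the affine map [y], so that [dirac_diff_conformal] applies. *)
Lemma weightA_monogenic theta z : mobius_nondeg a b c d -> c * z + d != 0 ->
  exists2 dA, is_diff z (weightA a b c d) dA & dirac_diff theta dA = 0.
Proof.
rewrite /mobius_nondeg /weightA; case: (eqVneq c 0) => [_ _ _|c0 beta0 cz0].
  exists 0; first exact: is_diff_cst.
  exact: dirac_diff0.
set beta := b - _ in beta0 *.
have y0 : c * z * beta^-1 + d * beta^-1 != 0.
  by rewrite -mulrDl qmul_eq0 invr_eq0 negb_or cz0.
have [dK DK dK0] := cauchy_kernel_monogenic theta y0.
have dy := is_diff_affine c beta^-1 (d * beta^-1) z.
have DKy := @is_diff_comp _ _ _ _ _ _ _ _ _ dy DK.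
have D := is_diff_qmul (is_diff_cst (qconj beta) z) DKy.
eexists; first exact: D.
have linK : linear dK by case: DK => _ <-; exact: linearP.
transitivity (dirac_diff theta (fun h =>
    qnorm beta ^+ 2 *: (beta^-1 * dK (c * h * beta^-1)))).
  congr dirac_diff; apply/funext => h /=.
  by rewrite mul0r addr0 qconj_qinv -scalerAl.
by rewrite dirac_diffZ dirac_diff_conformal // dK0 mulr0 !scaler0.
Qed.

(** Both values are explicit: with [N = |c z + d|^2] and [Nb = |beta|^2], the
scalar [t] is [N] if [c = 0] and [N * (Nb / N)^2] otherwise.  In the second case
[T z - a c^-1 = beta (c z + d)^-1] is the inverse of [y], whose squared norm is
[N / Nb]. *)
Lemma weight_factor z : mobius_nondeg a b c d -> c * z + d != 0 ->
  exists2 t, weightA a b c d z = t *: (c * z + d)^-1 &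
    weightB a b c d (T z) =
      (t * qnorm (c * z + d)^-1 ^+ 2) *: qconj (a - T z * c) /\
    weightB a b c d (T z) != 0.
Proof.
move=> nondeg cz0; have p0 := mobius_coef_neq0 nondeg cz0.
set N := qnorm (c * z + d) ^+ 2.
have N0 : N != 0 by rewrite qnorm_sqr_eq0.
suff [t A0 [t0 B0]] : exists2 t, weightA a b c d z = t *: (c * z + d)^-1 &
    t != 0 /\ weightB a b c d (T z) = (t * N^-1) *: qconj (a - T z * c).
  exists t; rewrite // qnorm_sqrV -/N; split => //.
  rewrite B0 qconj_qinv scaler_eq0 [t * _ == 0]mulf_eq0 scaler_eq0 !invr_eq0.
  by rewrite (negbTE t0) (negbTE N0) qnorm_sqr_eq0 (negbTE p0).
move: nondeg; rewrite /mobius_nondeg /weightA /weightB.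
case: (eqVneq c 0) => [cE _|c0 beta0].
  exists N; first by rewrite /N cE mul0r add0r qconj_qinv.
  by rewrite divff // scale1r cE mulr0 subr0.
set beta := b - _ in beta0 *.
set Nb := qnorm beta ^+ 2; have Nb0 : Nb != 0 by rewrite qnorm_sqr_eq0.
rewrite mobius_sub // -/beta; set w := beta * _.
have Nw : qnorm w ^+ 2 = Nb / N by rewrite qnorm_sqrM qnorm_sqrV.
exists (N * (Nb / N) ^+ 2).
  rewrite -mulrDl; set y := _ * beta^-1.
  have -> : qnorm y ^- 4 = (Nb / N) ^+ 2.
    rewrite (exprM _ 2 2) qnorm_sqrM qnorm_sqrV -/N -/Nb.
    by field; rewrite ?N0.
  by rewrite -scalerAr -qconjM /y divrK ?qunitE // qconj_qinv scalerA mulrC.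
split; first by rewrite mulf_neq0 // expf_neq0 // mulf_neq0 // invr_eq0.
rewrite mobius_coef // mobius_sub // -/beta -/w.
have -> : qnorm w ^+ 4 = (Nb / N) ^+ 2 by rewrite (exprM _ 2 2) Nw.
rewrite qconjN qconjM -mulNr -scalerAr; congr (_ *: _).
by field.
Qed.

End Mobius.

End DiracMobius.

(** * Conformal covariance of the perturbed Dirac operator *)

Theorem proposition3p4 (R : realType) (theta : R) (u v a b c d : quat R)
    (Omega Xi : set (quat R)) (f : quat R -> quat R)
    (T := mobius a b c d) (A := weightA a b c d) (B := weightB a b c d)
    (delta := delta_weight a b c d v Xi)
    (e := fun z : quat R => expR (theta_dot theta (v - u) z))
    (g := fun z : quat R => e z *: (A z * f (T z))) :
  0 <= theta < 2 * pi ->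
  mobius_nondeg a b c d ->
  domain Xi ->
  domain Omega ->
  (forall z, Xi z -> c * z + d != 0) ->
  T @` Xi = Omega ->
  C1_on Omega f ->
  forall z, Xi z ->
    (forall k : 'I_4, derivable g z (psi theta)`_k) /\
    dirac_w theta (fun=> u) g z
      = e z *: (B (T z) * dirac_w theta delta f (T z)).
Proof.
move=> _ nondeg _ _ cXi TXi fC1 z Xiz.
have cz0 := cXi z Xiz.
have [dA DA dA0] := weightA_monogenic theta nondeg cz0.
have [t At [Bt B0]] := weight_factor nondeg cz0.
have [|df _] := fC1 (T z); first by rewrite -TXi; exists z.
have [dg Dg] :=
  dirac_weighted_pullback (v - u) (is_diff_mobius a b cz0) DA dA0 At df.
split=> [k|]; first exact: diff_derivable.
have deltaE : delta (T z) = (B (T z))^-1 * v * A z.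
  rewrite /delta /delta_weight pinvKV ?inE // => x y; rewrite !inE => Xx Xy.
  by apply: mobius_inj => //; exact: cXi.
have zeroth : B (T z) * (delta (T z) * f (T z)) = v * (A z * f (T z)).
  by rewrite deltaE -!mulrA mulrA divrr ?qunitE // mul1r.
rewrite /dirac_w mulrDr zeroth [X in X + _ = _]Dg [B (T z)]Bt -scalerAl.
rewrite /g -(scalerAr (e z) u) -scalerDr; congr (_ *: _).
by rewrite mulrBl addrAC subrK addrC.
Qed.
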